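(* Let $b>0$. Let $f\in C(\mathbb{R})$ be strictly increasing with $f(0)=0$ and $f(s)\to\pm\infty$ as $s\to\pm\infty$. Let $g\in C(\mathbb{R})$ be positive and such that $|s|^{\alpha}g(s)\to C_\pm$ as $s\to\pm\infty$ for some exponent $\alpha\le 2$ and constants $C_\pm>0$. Let $u_0\in C([-b,b])$. Then there exists no viscosity solution in $C([-b,b]\times[0,\infty))$ of the singular Neumann problem $$u_t-f(g(u_x)u_{xx})=0\ \text{ in } (-b,b)\times(0,\infty),\qquad u_x(b,t)=\infty,\ u_x(-b,t)=-\infty\ \text{ for all } t>0,\qquad u(\cdot,0)=u_0\ \text{ in } [-b,b].$$
   Context: Notation: $Q=(-b,b)\times(0,\infty)$, $\overline{Q}=[-b,b]\times[0,\infty)$. The equation $u_t-f(g(u_x)u_{xx})=0$ in $Q$ with the boundary condition $u_x(\pm b,t)=\pm\infty$ for $t>0$ is understood in the following viscosity sense. Subsolution: an upper semicontinuous function $u$ on $\overline{Q}$ such that whenever $\phi\in C^2(\overline{Q})$ and $u-\phi$ attains a local maximum at $(x_0,t_0)\in Q$, one has $\phi_t(x_0,t_0)-f\big(g(\phi_x(x_0,t_0))\phi_{xx}(x_0,t_0)\big)\le 0$ (no condition is imposed at $x=\pm b$). Supersolution: a lower semicontinuous function $u$ on $\overline{Q}$ such that (i) whenever $\phi\in C^2(\overline{Q})$ and $u-\phi$ attains a local minimum at $(x_0,t_0)\in Q$, one has $\phi_t(x_0,t_0)-f\big(g(\phi_x(x_0,t_0))\phi_{xx}(x_0,t_0)\big)\ge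 0$; and (ii) for every $t>0$ and every $\phi\in C^2(\overline{Q})$, $u-\phi$ does not attain a local minimum (relative to $\overline{Q}$) at $(b,t)$ or at $(-b,t)$. Solution: a continuous function on $\overline{Q}$ that is both a subsolution and a supersolution. It is a solution of the initial-boundary value problem with initial value $u_0$ if moreover $u(\cdot,0)=u_0$ on $[-b,b]$. *)

(* Defs.v *)
From HB Require Import structures.
From mathcomp Require Import all_boot all_order all_algebra.
From mathcomp Require Import all_classical all_reals all_analysis.

Set Implicit Arguments.
Unset Strict Implicit.
Unset Printing Implicit Defensive.

Import Order.TTheory GRing.Theory Num.Theory.
Import numFieldNormedType.Exports.

Local Open Scope classical_set_scope.
Local Open Scope ring_scope.

Section SingularNeumann.
Context {R : realType}.
Implicit Types (b : R) (f g : R -> R) (u phi h : R * R -> R) (z : R * R).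

(* Points are pairs (x, t). Functions on the closed strip Qbar b are total
   functions on R * R of which only the values on Qbar b are ever used. *)
Definition Q b : set (R * R) := [set z | - b < z.1 < b /\ 0 < z.2].

Definition Qbar b : set (R * R) := [set z | - b <= z.1 <= b /\ 0 <= z.2].

Definition d_x h z : R := derive1 (fun x => h (x, z.2)) z.1.

Definition d_t h z : R := derive1 (fun t => h (z.1, t)) z.2.

Definition has_d_x h z : Prop := derivable (fun x => h (x, z.2)) z.1 1.

Definition has_d_t h z : Prop := derivable (fun t => h (z.1, t)) z.2 1.

Definition extends_to_Qbar b h : Prop :=
  exists2 k : R * R -> R,
    {within Qbar b, continuous k} & forall z, Q b z -> h z = k z.

Definition has_C0_partials b h : Prop :=
  [/\ forall z, Q b z -> has_d_x h z /\ has_d_t h z,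
      extends_to_Qbar b (d_x h)
    & extends_to_Qbar b (d_t h)].

(* C^2 up to the boundary: continuous on Qbar b, with all partial derivatives
   of order at most 2 existing in Q b and extending continuously to Qbar b. *)
Definition C2_Qbar b phi : Prop :=
  [/\ {within Qbar b, continuous phi},
      has_C0_partials b phi,
      has_C0_partials b (d_x phi)
    & has_C0_partials b (d_t phi)].

(* Semicontinuity relative to a set, via its subspace topology. *)
Definition lsc_on (A : set (R * R)) u : Prop :=
  lower_semicontinuous ((fun z => (u z)%:E) : subspace A -> \bar R).

Definition usc_on (A : set (R * R)) u : Prop := lsc_on A (fun z => - u z).

Definition local_max_on (A : set (R * R)) h z : Prop :=
  \forall w \near within A (nbhs z), h w <= h z.

Definition local_min_on (A : set (R * R)) h z : Prop :=
  \forall w \near within A (nbhs z), h z <= h w.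

(* phi_t - f (g (phi_x) phi_xx) *)
Definition pde_op f g phi z : R :=
  d_t phi z - f (g (d_x phi z) * d_x (d_x phi) z).

Definition subsolution b f g u : Prop :=
  usc_on (Qbar b) u /\
  forall phi z, C2_Qbar b phi -> Q b z ->
    local_max_on (Qbar b) (fun w => u w - phi w) z -> pde_op f g phi z <= 0.

Definition supersolution b f g u : Prop :=
  [/\ lsc_on (Qbar b) u,
      forall phi z, C2_Qbar b phi -> Q b z ->
        local_min_on (Qbar b) (fun w => u w - phi w) z ->
        0 <= pde_op f g phi z
    & forall phi t, C2_Qbar b phi -> 0 < t ->
        ~ local_min_on (Qbar b) (fun w => u w - phi w) (b, t) /\
        ~ local_min_on (Qbar b) (fun w => u w - phi w) (- b, t)].

Definition solution b f g u : Prop :=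
  [/\ {within Qbar b, continuous u},
      subsolution b f g u
    & supersolution b f g u].

Definition ibvp_solution b f g (u0 : R -> R) u : Prop :=
  solution b f g u /\ forall x, - b <= x <= b -> u (x, 0) = u0 x.

End SingularNeumann.

(* Main.v *)
Require Import Defs.
From mathcomp Require Import all_boot all_order all_algebra.
From mathcomp Require Import all_classical all_reals all_analysis.
From mathcomp Require Import ring lra.

Set Implicit Arguments.
Unset Strict Implicit.
Unset Printing Implicit Defensive.

Import Order.TTheory GRing.Theory Num.Theory.
Import numFieldNormedType.Exports.

Local Open Scope classical_set_scope.
Local Open Scope ring_scope.

(** The obstruction is the boundary condition at the right end alone. A classical
strict subsolution [phi], smooth up to [x = b], cannot touch a supersolution
from below on [x = b] for positive times, because the condition [u_x = +oo]
forbids any test function there. So on a thin rectangle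
[[b - del, b] x [0, 2]] the inequality [phi <= u] only has to be checked on
[x = b - del], [t = 0] and [t = 2]; it then also holds on [x = b]
([comparison_near_right_end]). A continuous [u] takes its values in some
[[m, M]] for [t <= 2] ([bounded_up_to_time]), hence it is enough to find
[phi] that is below [m] on those three sides and above [M] at [(b, 1)].

The exponent [alpha <= 2] is what makes such a [phi] available: it
gives [g p >= C / p ^ 2] for large [p] ([quadratic_lower_bound]), so that
[g (phi_x) phi_xx >= C phi_xx / phi_x ^ 2 = C (- 1 / phi_x)_x] for a convex
and steep [phi]. The profiles with [(- 1 / phi_x)_x = lam] are the logarithms
[phi = c - ln (b - x + e) / lam], and, the logarithm being unbounded, letting
the width [e] shrink raises the value at [x = b] as high as desired, while
away from [b] the profile stays bounded by its limit as [e] tends to [0].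
With [e] depending on [t] ([log_barrier]) the speed is
[phi_t = - e' / (lam (b - x + e)) <= - e' / (lam e)] where [e' <= 0]. Taking
[e = del exp (- lam V t (2 - t))] ([width]), the barrier rises by [V] at
[x = b] between times [0] and [1], falls back by time [2], and rises at speed
at most [2 V], where [V] depends on [M - m] only. Since [f] tends to [+oo],
[f (C lam) > 2 V] for [lam] large: [phi] is a strict subsolution wherever it
is steep enough, and [phi_x = 1 / (lam (b - x + e))] is as large as needed
once [del] is small compared with [1 / lam]. *)

(** * Test functions given by explicit formulas *)

Lemma Q_near_x (R : realType) (b : R) (z : R * R) :
  Q b z -> \forall x \near z.1, Q b (x, z.2).
Proof.
case=> /andP[lbz zb] z2; near=> x; split=> //=; apply/andP; split.
- by near: x; exact: lt_nbhsr.
- by near: x; exact: lt_nbhsl.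
Unshelve. all: by end_near. Qed.

Lemma Q_near_t (R : realType) (b : R) (z : R * R) :
  Q b z -> \forall t \near z.2, Q b (z.1, t).
Proof.
by case=> zb z2; near=> t; split=> //=; near: t; exact: lt_nbhsr.
Unshelve. all: by end_near. Qed.

(** The function [h] is only required to agree with [k] on the open set [Q b],
so that the lemma can be iterated: [h] may be a partial derivative [d_x phi],
whose values are known only where [phi] has been differentiated. *)
Lemma has_C0_partials_eq (R : realType) (b : R) (h k hx ht : R * R -> R) :
  (forall z, Q b z -> h z = k z) ->
  (forall z, Qbar b z -> {for z, continuous hx}) ->
  (forall z, Qbar b z -> {for z, continuous ht}) ->
  (forall z, Q b z -> is_derive z.1 1 (fun x => k (x, z.2)) (hx z)) ->
  (forall z, Q b z -> is_derive z.2 1 (fun t => k (z.1, t)) (ht z)) ->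
  [/\ has_C0_partials b h,
      forall z, Q b z -> d_x h z = hx z
    & forall z, Q b z -> d_t h z = ht z].
Proof.
move=> hk chx cht dkx dkt.
have dx z : Q b z -> is_derive z.1 1 (fun x => h (x, z.2)) (hx z).
  move=> Qz; apply: near_eq_is_derive (dkx z Qz).
  by have := Q_near_x Qz; apply: filterS => x Qx; rewrite hk.
have dt z : Q b z -> is_derive z.2 1 (fun t => h (z.1, t)) (ht z).
  move=> Qz; apply: near_eq_is_derive (dkt z Qz).
  by have := Q_near_t Qz; apply: filterS => t Qt; rewrite hk.
have dxE z : Q b z -> d_x h z = hx z.
  by move=> /dx[_ <-]; rewrite /d_x derive1E.
have dtE z : Q b z -> d_t h z = ht z.
  by move=> /dt[_ <-]; rewrite /d_t derive1E.
have ext (k' : R * R -> R) : (forall z, Qbar b z -> {for z, continuous k'}) ->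
    {within Qbar b, continuous k'}.
  move=> ck'; apply: continuous_in_subspaceT.
  by move=> z /set_mem /ck'.
split=> //; split.
- by move=> z Qz; split; [have [] := dx z Qz | have [] := dt z Qz].
- by exists hx => //; exact: ext.
- by exists ht => //; exact: ext.
Qed.

(** * The logarithmic barrier *)

Section log_barrier.
Context {R : realType}.
Variables (b lam c : R) (e e1 e2 : R -> R).
Hypothesis lam0 : 0 < lam.
Hypothesis e_gt0 : forall t, 0 < e t.
Hypothesis de : forall t : R, is_derive t 1 e (e1 t).
Hypothesis de1 : forall t : R, is_derive t 1 e1 (e2 t).
Hypothesis ce2 : continuous e2.

Definition gap (z : R * R) : R := b - z.1 + e z.2.

(** As a function of [x], the general solution of [w'' = lam w' ^ 2] that blows
up at [x = b + e t]. *)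
Definition log_barrier (z : R * R) : R := c - lam^-1 * ln (gap z).

Lemma gap_gt0 (z : R * R) : Qbar b z -> 0 < gap z.
Proof.
by case=> /andP[_ zb] _; rewrite /gap; have := e_gt0 z.2; lra.
Qed.

Lemma Q_sub_Qbar : Q b `<=` Qbar b.
Proof. by move=> z [/andP[? ?] ?]; split; [apply/andP; split|]; exact: ltW. Qed.

Let ce : continuous e.
Proof.
by move=> t; apply/differentiable_continuous/derivable1_diffP; case: (de t).
Qed.

Let ce1 : continuous e1.
Proof.
by move=> t; apply/differentiable_continuous/derivable1_diffP; case: (de1 t).
Qed.

Let continuous_time (k : R -> R) :
  continuous k -> continuous (fun z : R * R => k z.2).
Proof. by move=> ck z; apply: continuous_comp; [exact: cvg_snd|exact: ck]. Qed.

Lemma continuous_gap : continuous gap.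
Proof.
move=> z; apply: cvgD; last exact: continuous_time.
by apply: cvgB; [exact: cvg_cst|exact: cvg_fst].
Qed.

Lemma continuous_gapV (z : R * R) :
  Qbar b z -> {for z, continuous (fun w => (gap w)^-1)}.
Proof.
move=> /gap_gt0 z0; apply: cvgV; [by rewrite gt_eqF|exact: continuous_gap].
Qed.

Lemma is_derive_gap_x (z : R * R) :
  is_derive z.1 1 (fun x : R => gap (x, z.2)) (-1).
Proof.
rewrite /gap /=; apply: is_derive_eq.
by ring.
Qed.

Lemma is_derive_gap_t (z : R * R) :
  is_derive z.2 1 (fun t : R => gap (z.1, t)) (e1 z.2).
Proof.
rewrite /gap /=; apply: is_derive_eq.
by ring.
Qed.

Lemma is_derive_ln_comp (D : R -> R) (x d : R) : 0 < D x -> is_derive x 1 D d ->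
  is_derive x 1 (fun y => c - lam^-1 * ln (D y)) (- lam^-1 * d * (D x)^-1).
Proof.
move=> D0 dD; have dln := is_derive1_ln D0.
have dc := is_derive1_comp dln dD.
apply: is_derive_eq.
by rewrite /GRing.scale /=; ring.
Qed.

Lemma is_derive_divr (k D : R -> R) (x dk d : R) :
  0 < D x -> is_derive x 1 k dk -> is_derive x 1 D d ->
  is_derive x 1 (fun y => - lam^-1 * k y * (D y)^-1)
    (- lam^-1 * (dk * (D x)^-1 - k x * d * (D x)^-1 ^+ 2)).
Proof.
move=> D0 dk' dD; have dV := is_deriveV (lt0r_neq0 D0) dD.
apply: is_derive_eq.
by rewrite /GRing.scale /=; field; rewrite !gt_eqF.
Qed.

(** The gap is positive up to and including [x = b], so the barrier has no
singularity on [Qbar b] however small the width [e] is. *)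
Lemma log_barrier_C2 :
  [/\ C2_Qbar b log_barrier,
      forall z, Q b z -> d_x log_barrier z = lam^-1 * (gap z)^-1,
      forall z, Q b z -> d_x (d_x log_barrier) z = lam^-1 * (gap z)^-1 ^+ 2
    & forall z, Q b z -> d_t log_barrier z = - lam^-1 * e1 z.2 * (gap z)^-1].
Proof.
have cV (k : R * R -> R) (n : nat) z : Qbar b z -> {for z, continuous k} ->
    {for z, continuous (fun w => k w * (gap w)^-1 ^+ n)}.
  move=> Qz ck; apply: cvgM => //.
  apply: (@continuous_comp _ _ _ (fun w => (gap w)^-1) (fun y => y ^+ n)).
    exact: continuous_gapV.
  exact: exprn_continuous.
have cE (k : R -> R) (a : R) z :
    continuous k -> {for z, continuous (fun w : R * R => a * k w.2)}.
  by move=> ck; apply: cvgM; [exact: cvg_cst|exact: continuous_time].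
have [C1 xE tE] : [/\ has_C0_partials b log_barrier,
    forall z, Q b z -> d_x log_barrier z = - lam^-1 * -1 * (gap z)^-1
  & forall z, Q b z -> d_t log_barrier z = - lam^-1 * e1 z.2 * (gap z)^-1].
  apply: has_C0_partials_eq => // z Qz.
  - by apply: (cV _ 1%N) => //; exact: cvg_cst.
  - by apply: (cV _ 1%N) => //; exact: cE.
  - apply: is_derive_ln_comp; last exact: is_derive_gap_x.
    by case: z Qz => ? ? /= /Q_sub_Qbar/gap_gt0.
  - apply: is_derive_ln_comp; last exact: is_derive_gap_t.
    by case: z Qz => ? ? /= /Q_sub_Qbar/gap_gt0.
have gapQ z : Q b z -> 0 < gap (z.1, z.2).
  by case: z => ? ? /Q_sub_Qbar/gap_gt0.
have [C1x xxE _] : [/\ has_C0_partials b (d_x log_barrier),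
    forall z, Q b z -> d_x (d_x log_barrier) z =
      lam^-1 * 1 * (gap z)^-1 ^+ 2
  & forall z, Q b z -> d_t (d_x log_barrier) z =
      - lam^-1 * e1 z.2 * (gap z)^-1 ^+ 2].
  apply: has_C0_partials_eq xE _ _ _ _ => z Qz.
  - by apply: cV => //; exact: cvg_cst.
  - by apply: cV => //; exact: cE.
  - have dk := is_derive_cst (-1 : R) z.1 1.
    have dd := is_derive_divr (D := fun x => gap (x, z.2)) (gapQ z Qz) dk
      (is_derive_gap_x z).
    apply: (is_derive_eq dd).
    by rewrite /= -surjective_pairing; ring.
  - have dk := is_derive_cst (-1 : R) z.2 1.
    have dd := is_derive_divr (D := fun t => gap (z.1, t)) (gapQ z Qz) dk
      (is_derive_gap_t z).
    apply: (is_derive_eq dd).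
    by rewrite /= -surjective_pairing; ring.
have [C1t _ _] : [/\ has_C0_partials b (d_t log_barrier),
    forall z, Q b z -> d_x (d_t log_barrier) z =
      - lam^-1 * e1 z.2 * (gap z)^-1 ^+ 2
  & forall z, Q b z -> d_t (d_t log_barrier) z =
      - lam^-1 * e2 z.2 * (gap z)^-1
      - - lam^-1 * (e1 z.2 * e1 z.2) * (gap z)^-1 ^+ 2].
  apply: has_C0_partials_eq tE _ _ _ _ => z Qz.
  - by apply: cV => //; exact: cE.
  - apply: cvgB; first by apply: (cV _ 1%N) => //; exact: cE.
    apply: cV => //; apply: (cE (fun t => e1 t * e1 t)) => t.
    by apply: cvgM; exact: ce1.
  - have dk := is_derive_cst (e1 z.2) z.1 1.
    have dd := is_derive_divr (D := fun x => gap (x, z.2)) (gapQ z Qz) dk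
      (is_derive_gap_x z).
    apply: (is_derive_eq dd).
    by rewrite /= -surjective_pairing; ring.
  - have dd := is_derive_divr (D := fun t => gap (z.1, t)) (gapQ z Qz)
      (de1 z.2) (is_derive_gap_t z).
    apply: (is_derive_eq dd).
    by rewrite /= -surjective_pairing; ring.
split=> //; last 2 first.
- by move=> z Qz; rewrite xE //; ring.
- by move=> z Qz; rewrite xxE //; ring.
split=> //; apply: continuous_in_subspaceT => z /set_mem Qz.
apply: cvgB; first exact: cvg_cst.
apply: cvgM; first exact: cvg_cst.
apply: continuous_comp; first exact: continuous_gap.
exact/continuous_ln/gap_gt0.
Qed.
End log_barrier.

(** * The width of the barrier *)

Section collapsing_width.
Context {R : realType}.
Variables (a del : R).

(** The polynomial [t (2 - t)] vanishes at [0] and [2] and equals [1] at [1]: the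
width is [del] at both ends of [[0, 2]] and [del exp (- a)] in the middle.
Returning to [del] keeps the barrier low at the final time, so that the contact
time with a supersolution is interior to [[0, 2]]. *)
Definition width (t : R) : R := del * expR (- a * (t * (2 - t))).
Definition width1 (t : R) : R := - a * (2 - 2 * t) * width t.
Definition width2 (t : R) : R := (2 * a + (a * (2 - 2 * t)) ^+ 2) * width t.

Lemma is_derive_width (t : R) : is_derive t 1 width (width1 t).
Proof.
rewrite /width1 /width; apply: is_derive_eq.
by rewrite /GRing.scale /=; ring.
Qed.

Lemma is_derive_width1 (t : R) : is_derive t 1 width1 (width2 t).
Proof.
have dw := is_derive_width t.
rewrite /width2 /width1; apply: is_derive_eq.
by rewrite /GRing.scale /= /width1; ring.
Qed.

Lemma continuous_width2 : continuous width2.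
Proof.
move=> t; have dw := is_derive_width t.
apply/differentiable_continuous/derivable1_diffP.
by rewrite /width2; apply: derivableM.
Qed.

End collapsing_width.

(** * Growth of the diffusion coefficient *)

Lemma quadratic_lower_bound (R : realType) (g : R -> R) (alpha C : R) :
  (forall s, 0 < g s) -> alpha <= 2 -> 0 < C ->
  (`|s| `^ alpha * g s) @[s --> +oo] --> C ->
  exists2 s0 : R, 0 < s0 & forall s, s0 <= s -> C / 2 <= s ^+ 2 * g s.
Proof.
move=> g0 a2 C0 gC.
have C2 : C / 2 < C by lra.
have [N [_ NP]] := cvgr_gt C gC _ C2.
exists (Num.max 1 (N + 1)); first by rewrite lt_max ltr01.
move=> s; rewrite ge_max => /andP[s1 Ns].
have s0 : 0 <= s by lra.
apply: (le_trans (ltW (NP s _))); first lra.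
rewrite ler_wpM2r ?(ltW (g0 s))// ger0_norm// -powR_mulrn//.
exact: ler_powR.
Qed.

(** * Comparison on a rectangle touching the right end *)

(** If the minimum of [u - phi] on the rectangle were negative, it would be
attained off the three sides where [phi <= u], hence in a relatively open part
of [Qbar b]: there it is a local minimum on [Qbar b], and either the equation
(for [x < b]) or the singular boundary condition (for [x = b]) rules it out. *)
Lemma comparison_near_right_end (R : realType) (b T x0 : R) (f g : R -> R)
    (u phi : R * R -> R) :
  {within Qbar b, continuous u} -> supersolution b f g u -> C2_Qbar b phi ->
  - b < x0 ->
  (forall z, Q b z -> x0 < z.1 -> z.2 < T -> pde_op f g phi z < 0) ->
  (forall z, Qbar b z -> z.1 = x0 \/ z.2 = 0 \/ z.2 = T -> z.2 <= T ->
     x0 <= z.1 -> phi z <= u z) ->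
  forall z, Qbar b z -> x0 <= z.1 -> z.2 <= T -> phi z <= u z.
Proof.
move=> cu [_ uQ uB] Cphi bx0 pde bdry z [zb z0] xz zT.
rewrite leNgt; apply/negP => uphi.
pose K := `[x0, b] `*` `[0, T].
have KE w : K w <-> [/\ Qbar b w, x0 <= w.1 & w.2 <= T].
  rewrite /K /Qbar /= !in_itv /=; split.
    move=> [/andP[? ?] /andP[? ?]].
    by do !split => //; apply/andP; split=> //; lra.
  by move=> [[/andP[? ?] ?] ? ?]; split; apply/andP.
have KQ : K `<=` Qbar b by move=> w /KE[].
have cphi : {within Qbar b, continuous phi} by case: Cphi.
have K0 : K !=set0 by exists z; apply/KE.
have Kc : compact K by apply: compact_setX; exact: segment_compact.
have cd : {within K, continuous (fun w => u w - phi w)}.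
  apply: continuous_subspaceW KQ _ => w.
  by apply: continuousB; [exact: cu|exact: cphi].
have [w /set_mem Kw wmin] := compact_EVT_min K0 Kc cd.
have [Qw xw wT] := (KE w).1 Kw.
have uw : u w < phi w.
  have : u w - phi w <= u z - phi z by apply/wmin/mem_set/KE.
  by lra.
have xw' : x0 < w.1.
  rewrite lt_neqAle xw andbT; apply/eqP => E.
  by have := bdry w Qw (or_introl (esym E)) wT xw; lra.
have w0' : 0 < w.2.
  rewrite lt_neqAle (proj2 Qw) andbT; apply/eqP => E.
  by have := bdry w Qw (or_intror (or_introl (esym E))) wT xw; lra.
have wT' : w.2 < T.
  rewrite lt_neqAle wT andbT; apply/eqP => E.
  by have := bdry w Qw (or_intror (or_intror E)) wT xw; lra.
have lmin : local_min_on (Qbar b) (fun w => u w - phi w) w.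
  have nx : \forall v \near w, x0 < v.1.
    have wc : v.1 @[v --> w] --> w.1 by exact: cvg_fst.
    exact: (cvgr_gt _ wc).
  have nT : \forall v \near w, v.2 < T.
    have wc : v.2 @[v --> w] --> w.2 by exact: cvg_snd.
    exact: (cvgr_lt _ wc).
  rewrite /local_min_on near_withinE; near=> v => Qv.
  apply/wmin/mem_set/KE; split=> //; apply: ltW.
    by near: v.
  by near: v.
have [wb|wb] := ltP w.1 b.
  have Qw' : Q b w by split=> //; apply/andP; split=> //; lra.
  have := pde w Qw' xw' wT'.
  by have := uQ phi w Cphi Qw' lmin; lra.
have {}wb : w.1 = b by apply/eqP; rewrite eq_le wb andbT; case: Qw => /andP[].
have [+ _] := uB phi w.2 Cphi w0'; apply.
suff <- : w = (b, w.2) by [].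
by rewrite [LHS]surjective_pairing wb.
Unshelve. all: by end_near. Qed.

Lemma bounded_up_to_time (R : realType) (b T : R) (u : R * R -> R) :
  0 < b -> 0 <= T -> {within Qbar b, continuous u} ->
  exists m M : R, forall z, Qbar b z -> z.2 <= T -> m <= u z <= M.
Proof.
move=> b0 T0 cu; pose K := `[- b, b] `*` `[0, T].
have KE w : K w <-> Qbar b w /\ w.2 <= T.
  rewrite /K /Qbar /= !in_itv /=; split.
    by move=> [? /andP[? ?]].
  by move=> [[? ?] ?]; split=> //; apply/andP.
have K0 : K !=set0.
  exists (b, 0); apply/KE; split=> //.
  by split=> //=; apply/andP; split=> //; lra.
have Kc : compact K by apply: compact_setX; exact: segment_compact.
have cK : {within K, continuous u} by apply: continuous_subspaceW cu => w /KE[].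
have [p _ pmin] := compact_EVT_min K0 Kc cK.
have [q _ qmax] := compact_EVT_max K0 Kc cK.
exists (u p), (u q) => z Qz zT.
by rewrite pmin ?qmax//; apply/mem_set/KE.
Qed.

(** * Nonexistence *)

Theorem theorem1p2 (R : realType) (b : R) (f g u0 : R -> R)
    (alpha Cp Cm : R) :
  0 < b ->
  continuous f ->
  {homo f : x y / x < y} ->
  f 0 = 0 ->
  f s @[s --> +oo] --> +oo ->
  f s @[s --> -oo] --> -oo ->
  continuous g ->
  (forall s, 0 < g s) ->
  alpha <= 2 ->
  0 < Cp ->
  0 < Cm ->
  (`|s| `^ alpha * g s) @[s --> +oo] --> Cp ->
  (`|s| `^ alpha * g s) @[s --> -oo] --> Cm ->
  {within `[- b, b], continuous u0} ->
  ~ exists u : R * R -> R, ibvp_solution b f g u0 u.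
Proof.
move=> b0 _ f_lt _ f_oo _ _ g0 a2 Cp0 _ gCp _ _ [u [[cu _ sup] _]].
have [s0 s0_gt0 gs0] := quadratic_lower_bound g0 a2 Cp0 gCp.
have f_le : {homo f : x y / x <= y} := ltW_homo f_lt.
have [m [M umM]] := bounded_up_to_time b0 (ler0n R 2) cu.
have Qb1 : Qbar b (b, 1) by split=> //=; apply/andP; split=> //; lra.
(* The rise of the barrier at [b], enough to go from [m] to above [M]. *)
pose V := M - m + 1.
have V0 : 0 < V by have /andP[] := umM _ Qb1 (ler1n R 2); rewrite /V; lra.
have [lam lam0 flam] : exists2 lam : R, 0 < lam & 2 * V < f (lam * (Cp / 2)).
  have [N [_ NP]] := (cvgryPgt _).1 f_oo (2 * V).
  exists ((Num.max N 0 + 1) / (Cp / 2)).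
    by rewrite !divr_gt0 // ltr_pwDr // le_max lexx orbT.
  rewrite divfK; last by rewrite gt_eqF // divr_gt0.
  by apply: NP; rewrite ltr_pwDr // le_max lexx.
(* On the rectangle the gap is at most [2 del], so this choice of [del] makes the
   slope [1 / (lam * gap)] at least [s0] there. *)
pose del := Num.min b (2 * lam * s0)^-1.
have ls0 : 0 < 2 * lam * s0 by rewrite !mulr_gt0.
have del0 : 0 < del by rewrite lt_min b0 invr_gt0.
have delb : del <= b by rewrite ge_min lexx.
have dells : 2 * del * lam * s0 <= 1.
  have : del <= (2 * lam * s0)^-1 by rewrite ge_min lexx orbT.
  by rewrite -[leRHS]mul1r ler_pdivlMr//; lra.
pose e := width (lam * V) del.
have e0 t : 0 < e t by rewrite mulr_gt0 // expR_gt0.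
have e_le t : 0 <= t <= 2 -> e t <= del.
  move=> /andP[t0 t2]; rewrite ger_pMr // -[leRHS]expR0 ler_expR mulNr oppr_le0.
  have lamV0 : 0 <= lam * V by rewrite ltW // mulr_gt0.
  by apply: mulr_ge0 => //; apply: mulr_ge0; lra.
(* The constant term makes the barrier equal to [m] where the gap is [del], and
   lower where the gap is larger. *)
have [Cphi phix phixx phit] := log_barrier_C2 b (m + lam^-1 * ln del) lam0 e0
  (is_derive_width _ _) (is_derive_width1 _ _) (@continuous_width2 _ _ _).
set phi := log_barrier _ _ _ _ in Cphi phix phixx phit.
have key : forall z, Qbar b z -> b - del <= z.1 -> z.2 <= 2 -> phi z <= u z.
  apply: (comparison_near_right_end cu sup Cphi); first lra.
  - move=> z Qz xz z2.
    have D0 : 0 < gap b e z by apply: (gap_gt0 e0); exact: Q_sub_Qbar.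
    have [/andP[_ zb] zt] := Qz.
    have eD : e z.2 <= gap b e z by rewrite /gap; lra.
    have D2 : gap b e z <= 2 * del.
      have : e z.2 <= del by apply: e_le; apply/andP; split; exact: ltW.
      by rewrite /gap; lra.
    rewrite /pde_op phix // phixx // phit //.
    set p := lam^-1 / gap b e z.
    have ps : s0 <= p.
      rewrite /p -invfM -[leRHS]mul1r ler_pdivlMr ?mulr_gt0 //.
      apply: le_trans dells; rewrite mulrC [leRHS]mulrAC.
      have : lam * gap b e z * s0 <= lam * (2 * del) * s0.
        by rewrite ler_pM2r // ler_pM2l.
      by lra.
    (* This is [phi_xx = lam * phi_x ^ 2] for the logarithmic profile. *)
    have pxx : g p * (lam^-1 * (gap b e z)^-1 ^+ 2) = lam * (p ^+ 2 * g p).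
      by rewrite /p; field; rewrite !gt_eqF.
    have fV : 2 * V < f (g p * (lam^-1 * (gap b e z)^-1 ^+ 2)).
      rewrite pxx; apply: (lt_le_trans flam); apply: f_le.
      by rewrite ler_pM2l // gs0.
    suff : - lam^-1 * width1 (lam * V) del z.2 / gap b e z <= 2 * V by lra.
    have -> : - lam^-1 * width1 (lam * V) del z.2 / gap b e z =
        V * (2 - 2 * z.2) * (e z.2 / gap b e z).
      by rewrite /width1 -/e; field; rewrite !gt_eqF.
    have r1 : e z.2 / gap b e z <= 1 by rewrite ler_pdivrMr // mul1r.
    have r0 : 0 <= e z.2 / gap b e z by rewrite divr_ge0 // ltW.
    have : V * (e z.2 / gap b e z) <= V by rewrite ger_pMr.
    have : 0 <= V * (e z.2 / gap b e z) * z.2.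
      by apply: mulr_ge0; [apply: mulr_ge0 => //; exact: ltW|exact: ltW].
    by lra.
  - move=> z Qz zbd z2 xz.
    have /andP[mu _] := umM z Qz z2; apply: (le_trans _ mu).
    have D0 : 0 < gap b e z by exact: (gap_gt0 e0).
    have dD : del <= gap b e z.
      have [/andP[_ zb] _] := Qz; rewrite /gap.
      have := e0 z.2.
      case: zbd => [->|zt]; first lra.
      suff -> : e z.2 = del by lra.
      by rewrite /e /width; case: zt => ->;
        rewrite ?subrr ?mul0r ?mulr0 expR0 mulr1.
    have : lam^-1 * ln del <= lam^-1 * ln (gap b e z).
      by rewrite ler_pM2l ?invr_gt0 // ler_ln.
    by rewrite /phi /log_barrier; lra.
have uphi : phi (b, 1) <= u (b, 1) by apply: key => //=; lra.
have /andP[_ uM] := umM _ Qb1 (ler1n R 2).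
suff : phi (b, 1) = m + V by rewrite /V; lra.
rewrite /phi /log_barrier /gap /= subrr add0r /e /width.
rewrite lnM ?posrE ?expR_gt0 // expRK.
by field; rewrite gt_eqF.
Qed.
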